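(* Let $H$ be a complex Hilbert space, let $\{f_k\}_{k=1}^\infty$ be a frame for $H$ with frame operator $S$, and let $\{S^{-1}f_k\}_{k=1}^\infty$ be its canonical dual frame. Let $G$ be the cross-Gram operator associated to $\{\langle f_k,S^{-1}f_j\rangle\}_{j,k=1}^\infty$. Then $G$ is a self-adjoint and positive operator on $\ell^2(\mathbb{N})$.
   Context: Inner products are linear in the first argument. A sequence $\{f_k\}_{k=1}^\infty\subset H$ is a frame for $H$ if there are constants $A,B>0$ with $A\|f\|^2\le\sum_{k=1}^\infty|\langle f,f_k\rangle|^2\le B\|f\|^2$ for all $f\in H$. Its frame operator is $S:H\to H$, $Sf=\sum_{k=1}^\infty\langle f,f_k\rangle f_k$, which is bounded and invertible. The cross-Gram operator associated to $\{\langle f_k,g_j\rangle\}_{j,k=1}^\infty$ (here with $g_j=S^{-1}f_j$) is the bounded operator $G:\ell^2(\mathbb{N})\to\ell^2(\mathbb{N})$, $G\{c_k\}_{k=1}^\infty=\left\{\left\langle\sum_{\ell=1}^\infty c_\ell f_\ell,g_j\right\rangle\right\}_{j=1}^\infty$, whose matrix has $(j,k)$ entry $\langle f_k,g_j\rangle$. Positive means $\langle Gc,c\rangle\ge 0$ for all $c\in\ell^2(\mathbb{N})$. *)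

(* Defs.v *)
From HB Require Import structures.
From mathcomp Require Import all_boot all_order all_algebra.
From mathcomp Require Import complex.
From mathcomp Require Import all_classical all_reals all_analysis.

Set Implicit Arguments.
Unset Strict Implicit.
Unset Printing Implicit Defensive.

Import Order.TTheory GRing.Theory Num.Theory numFieldNormedType.Exports.

Local Open Scope classical_set_scope.
Local Open Scope ring_scope.

(* The norm of a normed module over R[i], as well as the modulus of a complex
   number, takes its values in R[i]; [rnorm] is the same norm, read in R. *)
Definition rnorm (R : realType) (V : normedZmodType R[i]) (x : V) : R :=
  complex.Re `|x|.

(* A series is summed in the extended reals, hence is always meaningful: it is
   +oo exactly when c is not square-summable. *)
Definition sqsum (R : realType) (c : nat -> R[i]) : \bar R :=
  (\sum_(0 <= k <oo) (rnorm (c k) ^+ 2)%:E)%E.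

Definition ell2 (R : realType) : set (nat -> R[i]) :=
  [set c | (sqsum c < +oo)%E].

(* Linear in the first argument; the series converges for c, d in ell2. The
   field of scalars is kept abstract (it is R[i] below) because the topology of
   a numFieldType is found much faster on an abstract field than on R[i]. *)
Definition ell2_dot (C : numClosedFieldType) (c d : nat -> C) : C :=
  limn (series (fun k => c k * (d k)^*)).

Definition ell2_bounded_operator (R : realType)
    (T : (nat -> R[i]) -> (nat -> R[i])) : Prop :=
  [/\ (forall c, ell2 c -> ell2 (T c)),
      (forall (a : R[i]) c d, ell2 c -> ell2 d ->
         T (fun k => a * c k + d k) = (fun k => a * T c k + T d k))
    & exists2 M : R, 0 <= M &
        forall c, ell2 c -> (sqsum (T c) <= (M ^+ 2)%:E * sqsum c)%E].

(* T coincides with its Hilbert space adjoint on ell2. *)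
Definition ell2_self_adjoint (R : realType)
    (T : (nat -> R[i]) -> (nat -> R[i])) : Prop :=
  forall c d, ell2 c -> ell2 d -> ell2_dot (T c) d = ell2_dot c (T d).

(* 0 <= z in R[i] means that z is real and nonnegative. *)
Definition ell2_positive (R : realType)
    (T : (nat -> R[i]) -> (nat -> R[i])) : Prop :=
  forall c, ell2 c -> 0 <= ell2_dot (T c) c.

Section Frames.
Variables (R : realType) (H : completeNormedModType R[i]).
Variable ip : {dot H for Num.conj}.

(* Together with the completeness of H, this makes (H, ip) a Hilbert space. *)
Definition induces_norm : Prop := forall x : H, ip x x = `|x| ^+ 2.

Definition is_frame (f : nat -> H) : Prop :=
  exists A B : R, [/\ 0 < A, 0 < B &
    forall x : H,
      ((A * rnorm x ^+ 2)%:E <= sqsum (fun k => ip x (f k)))%E /\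
      (sqsum (fun k => ip x (f k)) <= (B * rnorm x ^+ 2)%:E)%E].

Definition frame_operator (f : nat -> H) (x : H) : H :=
  limn (series (fun k => ip x (f k) *: f k)).

(* [pinv setT S] is the inverse of S when S is bijective, which is the case for
   the frame operator of a frame. *)
Definition canonical_dual (f : nat -> H) (k : nat) : H :=
  pinv setT (frame_operator f) (f k).

Definition cross_gram (f g : nat -> H) (c : nat -> R[i]) : nat -> R[i] :=
  fun j => ip (limn (series (fun l => c l *: f l))) (g j).

End Frames.

(* Main.v *)
(* Let T c = sum_l c_l f_l be the synthesis operator and S the frame operator.
   The upper frame bound makes T and S bounded, and the lower one makes S
   coercive, hence surjective; S is self-adjoint, so (G c)_j = <S^-1 T c, f_j>.
   Since T is adjoint to x |-> (<x, f_j>)_j, one gets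
   <G c, d> = <S^-1 T c, T d>, which is hermitian, and nonnegative for c = d.
   Moreover |G c|^2 = <T c, S^-1 T c> = <c, G c>, so that |G c| <= |c|. *)
Require Import Defs.
From mathcomp Require Import all_boot all_order all_algebra.
From mathcomp Require Import complex.
From mathcomp Require Import all_classical all_reals all_analysis.
From mathcomp Require Import ring lra.
Import Order.TTheory GRing.Theory Num.Theory numFieldNormedType.Exports.
Local Open Scope ring_scope.

Set Implicit Arguments.
Unset Strict Implicit.
Unset Printing Implicit Defensive.

(** * Limits in normed modules over a partially ordered field *)

(** The order on [C] is only partial, but being nonnegative amounts to being equal to one's norm,
    and this equation passes to the limit. *)
Lemma cvgn_ge0 (C : numFieldType) (u : nat -> C) (l : C) :
  (u @ \oo --> l)%classic -> (\forall n \near \oo%classic, 0 <= u n) -> 0 <= l.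
Proof.
move=> ul u0.
suff -> : l = `|l| by [].
apply: (cvg_unique (@norm_hausdorff _ _) ul).
apply: cvg_trans (cvg_norm ul).
apply: near_eq_cvg; near=> n; rewrite ger0_norm //; near: n; exact: u0.
Unshelve. all: by end_near. Qed.

Lemma cvgn_sqr_norm_le (C : numFieldType) (V : normedModType C) (u : nat -> V)
    (l : V) (K : C) :
  (u @ \oo --> l)%classic -> (forall n, `|u n| ^+ 2 <= K) -> `|l| ^+ 2 <= K.
Proof.
move=> ul uK; rewrite -subr_ge0.
apply: (@cvgn_ge0 _ (fun n => K - `|u n| * `|u n|)); last first.
  by near=> n; rewrite subr_ge0 -expr2.
apply: cvgB; first exact: cvg_cst.
by rewrite expr2; apply: cvgM; exact: cvg_norm.
Unshelve. all: by end_near. Qed.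

Lemma cvgn_lipschitz (C : numFieldType) (V W : normedModType C)
    (u : nat -> V) (l : V) (v : nat -> W) (m : W) (K : C) :
  0 <= K -> (u @ \oo --> l)%classic ->
  (forall n, `|v n - m| <= K * `|u n - l|) -> (v @ \oo --> m)%classic.
Proof.
move=> K0 ul vuK; apply/subr_cvg0/cvgr0Pnorm_lt => e e0.
(* [K] may be 0, so [e] is divided by [K + 1] instead. *)
have K1 : 0 < K + 1 by rewrite ltr_wpDl.
near=> n; apply: le_lt_trans (vuK n) _.
have un : `|u n - l| < e / (K + 1).
  by near: n; apply: cvgr_distC_lt ul _ _; rewrite divr_gt0.
rewrite -(@divfK _ (K + 1) _ e) ?gt_eqF// mulrC.
rewrite (@le_lt_trans _ _ (`|u n - l| * (K + 1))) ?ltr_pM2r//.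
by rewrite ler_wpM2l// lerDl.
Unshelve. all: by end_near. Qed.

Lemma cvgn_series_linear (C : numFieldType) (V : normedModType C) (a : C)
    (u v : nat -> V) (x y : V) :
  (series u @ \oo --> x)%classic -> (series v @ \oo --> y)%classic ->
  (series (fun k => a *: u k + v k) @ \oo --> a *: x + y)%classic.
Proof.
move=> ux vy; apply: cvg_trans (cvgD (cvgZr (k := a) ux) vy).
apply: near_eq_cvg; near=> n.
by rewrite /series/= !fctE /= scaler_sumr -big_split.
Unshelve. all: by end_near. Qed.

(** * Cauchy-Schwarz, and inner products of convergent series *)

Section InnerProduct.
Variables (C : numClosedFieldType) (H : normedModType C).
Variable ip : {dot H for Num.conj}.
Hypothesis ip_norm : forall x : H, ip x x = `|x| ^+ 2.

Lemma ipC x y : ip y x = (ip x y)^*.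
Proof. by rewrite hermC expr0 mul1r. Qed.

Lemma ipZl a x y : ip (a *: x) y = a * ip x y.
Proof. exact: linearZl_LR. Qed.

Lemma ipZr a x y : ip x (a *: y) = a^* * ip x y.
Proof. exact: linearZr_LR. Qed.

(** Cauchy-Schwarz: the squared norm of <y,y> x - <x,y> y equals <y,y> (<x,x> <y,y> - |<x,y>|^2),
    from which the factor <y,y> > 0 is cancelled. *)
Lemma ip_le_norm x y : `|ip x y| <= `|x| * `|y|.
Proof.
rewrite -ler_sqr ?nnegrE ?mulr_ge0 // exprMn.
have [->|y0] := eqVneq y 0; first by rewrite linear0r !normr0 expr0n mulr0.
have y20 : 0 < ip y y by exact: neq0_dnorm_gt0.
have := dnorm_ge0 ip (ip y y *: x - ip x y *: y).
rewrite dnormB !dnormZ ipZl ipZr (ger0_norm (ltW y20)) -(ip_norm x) -(ip_norm y).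
rewrite !rmorphM /= conjCK (CrealP (ger0_real (ltW y20))) normCK => h.
rewrite -(ler_pM2r y20) -subr_ge0; move: h; congr (0 <= _).
move: (ip x x) (ip y y) (ip x y) (_^*) => a b c d; ring.
Qed.

Lemma cvgn_ipl (u : nat -> H) l y :
  (u @ \oo --> l -> (fun n => ip (u n) y) @ \oo --> ip l y)%classic.
Proof.
move=> ul; apply: (@cvgn_lipschitz _ _ _ u l _ _ `|y| _ ul) => // n.
by rewrite -linearBl mulrC ip_le_norm.
Qed.

Lemma cvgn_ipr (u : nat -> H) l y :
  (u @ \oo --> l -> (fun n => ip y (u n)) @ \oo --> ip y l)%classic.
Proof.
move=> ul; apply: (@cvgn_lipschitz _ _ _ u l _ _ `|y| _ ul) => // n.
by rewrite -linearBr ip_le_norm.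
Qed.

Lemma cvgn_series_ipr (f : nat -> H) (c : nat -> C) (x y : H) :
  (series (fun k => c k *: f k) @ \oo --> x ->
   series (fun k => c k * (ip y (f k))^*) @ \oo --> ip x y)%classic.
Proof.
move=> /(@cvgn_ipl _ _ y); apply: cvg_trans.
apply: near_eq_cvg; near=> n.
rewrite /series/= linear_sumlz; apply: eq_bigr => k _.
by rewrite /= ipZl -ipC.
Unshelve. all: by end_near. Qed.

Lemma cvgn_series_ipl (f : nat -> H) (c : nat -> C) (x y : H) :
  (series (fun k => c k *: f k) @ \oo --> x ->
   series (fun k => ip y (f k) * (c k)^*) @ \oo --> ip y x)%classic.
Proof.
move=> /(@cvgn_ipr _ _ y); apply: cvg_trans.
apply: near_eq_cvg; near=> n.
rewrite /series/= linear_sumr; apply: eq_bigr => k _.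
by rewrite /= ipZr mulrC.
Unshelve. all: by end_near. Qed.

(** Synthesis is adjoint to analysis as soon as the synthesis series of [c] converges: by continuity
    the inner product passes through the sum. *)
Lemma ell2_dot_analysisr (f : nat -> H) (c : nat -> C) (x y : H) :
  (series (fun k => c k *: f k) @ \oo --> x)%classic ->
  ell2_dot c (fun k => ip y (f k)) = ip x y.
Proof. by move=> /cvgn_series_ipr fx; apply: cvg_lim (fx y); exact: norm_hausdorff. Qed.

Lemma ell2_dot_analysisl (f : nat -> H) (c : nat -> C) (x y : H) :
  (series (fun k => c k *: f k) @ \oo --> x)%classic ->
  ell2_dot (fun k => ip y (f k)) c = ip y x.
Proof. by move=> /cvgn_series_ipl fx; apply: cvg_lim (fx y); exact: norm_hausdorff. Qed.

(** Expanding 0 <= sum |c_k - <z, f_k>|^2 and letting the cross terms converge gives 2 <x,z> <= M +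
    <x,z>. With z = S^-1 x this yields |G c| <= |c|. *)
Lemma ip_le_sqsum (f : nat -> H) (c : nat -> C) (x z : H) (M : C) :
  (series (fun k => c k *: f k) @ \oo --> x)%classic ->
  (forall n, \sum_(0 <= k < n) `|c k| ^+ 2 <= M) ->
  (forall n, \sum_(0 <= k < n) `|ip z (f k)| ^+ 2 <= ip x z) -> ip x z <= M.
Proof.
move=> cx cM fz.
(* The empty sum in [fz] shows that <x,z> is real, so both cross terms have the same limit. *)
have xz0 : 0 <= ip x z by have := fz 0; rewrite big_geq.
have zx : ip z x = ip x z by rewrite ipC (CrealP (ger0_real xz0)).
rewrite -subr_ge0 (_ : M - _ = M + ip x z - (ip x z + ip x z)); last by ring.
apply: (@cvgn_ge0 _ (fun n => M + ip x z -
    (series (fun k => c k * (ip z (f k))^*) n +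
     series (fun k => ip z (f k) * (c k)^*) n))).
  apply: cvgB; first exact: cvg_cst.
  by rewrite -{2}zx; apply: cvgD; [exact: cvgn_series_ipr|exact: cvgn_series_ipl].
near=> n; rewrite subr_ge0 (le_trans _ (lerD (cM n) (fz n)))//.
rewrite /series/= -!big_split; apply: ler_sum => k _ /=.
have : 0 <= `|c k - ip z (f k)| ^+ 2 by rewrite exprn_ge0.
rewrite -subr_ge0 !normCK rmorphB /=; congr (0 <= _).
move: (c k) (ip z (f k)) (_^*) (_^*) => a b d e; ring.
Unshelve. all: by end_near. Qed.

(* AM-GM: 2 B Re (c <f, s>) <= B^2 |c|^2 + |<s, f>|^2; summing gives
   2 B |s|^2 on the left and at most B |s|^2 from the last term. *)
Lemma bessel_sum_le (f : nat -> H) (B : C) (m n : nat) (c : nat -> C) :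
  0 < B ->
  (forall x, \sum_(m <= k < n) `|ip x (f k)| ^+ 2 <= B * `|x| ^+ 2) ->
  `|\sum_(m <= k < n) c k *: f k| ^+ 2 <= B * \sum_(m <= k < n) `|c k| ^+ 2.
Proof.
move=> B0 /(_ (\sum_(m <= k < n) c k *: f k)).
set s := \sum_(_ <= k < _) _ *: _ => bs.
have sE : ip s s = \sum_(m <= k < n) c k * (ip s (f k))^*.
  rewrite {1}/s linear_sumlz; apply: eq_bigr => k _.
  by rewrite /= ipZl -ipC.
have sE' : ip s s = \sum_(m <= k < n) (c k)^* * ip s (f k).
  by rewrite {2}/s linear_sumr; apply: eq_bigr => k _; rewrite /= ipZr.
have h : B * (ip s s + ip s s) <= 
    B ^+ 2 * (\sum_(m <= k < n) `|c k| ^+ 2) + \sum_(m <= k < n) `|ip s (f k)| ^+ 2.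
  rewrite {1}sE sE' -big_split/= !mulr_sumr -big_split/=.
  apply: ler_sum => k _.
  have : 0 <= `|B * c k - ip s (f k)| ^+ 2 by rewrite exprn_ge0.
  rewrite -subr_ge0 !normCK rmorphB rmorphM/= (CrealP (ger0_real (ltW B0))).
  congr (0 <= _).
  move: (c k) (ip s (f k)) (_^*) (_^*) => a b d e; ring.
rewrite ip_norm in h.
rewrite -(ler_pM2l B0).
rewrite [leRHS]mulrA -(expr2 B) -(lerD2r (B * `|s| ^+ 2)) -mulrDr.
by rewrite (le_trans h)// lerD2l.
Qed.

End InnerProduct.

(** * Real-valued norms, a Cauchy criterion and square sums *)

Lemma rnormE (R : realType) (V : normedZmodType R[i]) (x : V) :
  `|x| = (rnorm x)%:C%C.
Proof. by rewrite /rnorm RRe_real ?normr_real. Qed.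

Lemma conjC_real (R : realType) (a : R) : (a%:C%C)^* = a%:C%C :> R[i].
Proof. exact: conjc_real. Qed.

Lemma cvgn_of_dominated_increments (R : realType) (V : completeNormedModType R[i])
    (u : nat -> V) (a : nat -> R) :
  (forall m n, (m <= n)%N -> `|u n - u m| ^+ 2 <= (a m)%:C%C) ->
  (a @ \oo --> 0)%classic -> (cvgn u)%classic.
Proof.
move=> ua a0; apply: cauchy_cvg; apply: cauchy_exP => eps eps0.
have epsE : eps = (complex.Re eps)%:C%C by rewrite RRe_real ?gtr0_real.
have e0 : 0 < complex.Re eps by rewrite -ltcR -epsE.
have : \forall m \near \oo%classic, `|a m| < complex.Re eps ^+ 2.
  by apply: cvgr0_norm_lt a0 _ _; rewrite exprn_gt0.
(* [cauchy_exP] asks only for some ball of radius [eps] containing a tail of [u]; the ball around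
   [u m] works for any [m] with |a m| < eps^2. *)
case=> m _ /(_ m (leqnn m)) am.
exists (u m); exists m => // n /= mn.
rewrite -ball_normE /= distrC -ltr_sqr ?nnegrE// ?(ltW eps0)//.
apply: le_lt_trans (ua m n mn) _.
by rewrite epsE -rmorphXn/= ltcR (le_lt_trans (ler_norm _)).
Qed.

Section SquareSums.
Variables (R : realType) (c : nat -> R[i]).

Lemma sqsum_ge_partial n :
  ((\sum_(0 <= k < n) rnorm (c k) ^+ 2)%:E <= sqsum c)%E.
Proof. by rewrite -sumEFin; apply: nneseries_lim_ge => k _ _; rewrite lee_fin sqr_ge0. Qed.

Lemma sqsum_le (M : R) :
  (forall n, \sum_(0 <= k < n) rnorm (c k) ^+ 2 <= M) -> (sqsum c <= M%:E)%E.
Proof.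
move=> cM; apply: lime_le.
  by apply: is_cvg_nneseries => k _ _; rewrite lee_fin sqr_ge0.
by near=> n; rewrite sumEFin lee_fin.
Unshelve. all: by end_near. Qed.

Lemma ell2_series_cvgn : ell2 c ->
  exists2 M : R, sqsum c = M%:E & (series (fun k => rnorm (c k) ^+ 2) @ \oo --> M)%classic.
Proof.
move=> c2.
have c0 : (0 <= sqsum c)%E by apply: nneseries_ge0 => k _ _; rewrite lee_fin sqr_ge0.
have cE : sqsum c = (fine (sqsum c))%:E by rewrite fineK// ge0_fin_numE.
exists (fine (sqsum c)) => //.
have cM : ((fun n => \sum_(0 <= k < n) (rnorm (c k) ^+ 2)%:E)%E @ \oo
    --> (fine (sqsum c))%:E)%classic.
  by rewrite -cE; apply: is_cvg_nneseries => k _ _; rewrite lee_fin sqr_ge0.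
apply: cvg_trans (fine_cvg cM).
by apply: near_eq_cvg; near=> n; rewrite /= sumEFin.
Unshelve. all: by end_near. Qed.

Lemma normr_sum_sqrE m n : \sum_(m <= k < n) `|c k| ^+ 2 =
  (\sum_(m <= k < n) rnorm (c k) ^+ 2)%:C%C.
Proof. by rewrite rmorph_sum; apply: eq_bigr => k _ /=; rewrite rnormE rmorphXn. Qed.

End SquareSums.

(** * Synthesis and frame operators under the upper frame bound *)

Section Bessel.
Variables (R : realType) (H : completeNormedModType R[i]).
Variable ip : {dot H for Num.conj}.
Hypothesis ip_norm : induces_norm ip.
Variables (f : nat -> H) (B : R).
Hypothesis B0 : 0 < B.
Hypothesis fB : forall x : H,
  (sqsum (fun k => ip x (f k)) <= (B * rnorm x ^+ 2)%:E)%E.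

Lemma bessel_partial m n x :
  \sum_(m <= k < n) `|ip x (f k)| ^+ 2 <= B%:C%C * `|x| ^+ 2.
Proof.
rewrite normr_sum_sqrE rnormE -rmorphXn -rmorphM /= lecR -lee_fin.
apply: le_trans (fB x); apply: le_trans (sqsum_ge_partial _ n).
rewrite lee_fin; have [mn|nm] := leqP m n; last first.
  by rewrite big_geq 1?ltnW// sumr_ge0// => k _; exact: sqr_ge0.
by rewrite (big_cat_nat (leq0n m) mn)/= lerDr sumr_ge0// => k _; exact: sqr_ge0.
Qed.

Lemma synthesis_partial c m n :
  `|\sum_(m <= k < n) c k *: f k| ^+ 2 <=
  (B * \sum_(m <= k < n) rnorm (c k) ^+ 2)%:C%C.
Proof.
rewrite rmorphM/= -normr_sum_sqrE; apply: (bessel_sum_le ip_norm).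
  by rewrite ltcR.
by move=> x; exact: bessel_partial.
Qed.

Lemma synthesis_cvgn c : ell2 c -> (cvgn (series (fun k => c k *: f k)))%classic.
Proof.
move=> /ell2_series_cvgn [M cM sM].
(* The dominating sequence is [B] times the tail of the series of |c_k|^2. *)
apply: (@cvgn_of_dominated_increments _ _ _
  (fun m => B * (M - series (fun k => rnorm (c k) ^+ 2) m))).
  move=> m n mn; rewrite sub_series_geq//.
  apply: le_trans (synthesis_partial c m n) _.
  rewrite lecR ler_pM2l// lerBrDl -[X in X + _]/(series _ m).
  rewrite -(sub_series_geq _ mn) addrC subrK -lee_fin -cM.
  exact: sqsum_ge_partial.
rewrite -(mulr0 B) -(subrr M); apply: cvgMr; apply: cvgB => //; exact: cvg_cst.
Qed.

Lemma synthesis_norm c (M : R) x : sqsum c = M%:E ->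
  (series (fun k => c k *: f k) @ \oo --> x)%classic -> `|x| ^+ 2 <= (B * M)%:C%C.
Proof.
move=> cM cx; apply: cvgn_sqr_norm_le cx _ => n.
apply: le_trans (synthesis_partial c 0 n) _.
by rewrite lecR ler_pM2l// -lee_fin -cM; exact: sqsum_ge_partial.
Qed.

Lemma analysis_ell2 x : ell2 (fun k => ip x (f k)).
Proof. by apply: le_lt_trans (fB x) _; rewrite ltry. Qed.

Lemma frame_operator_cvgn x :
  (series (fun k => ip x (f k) *: f k) @ \oo --> frame_operator ip f x)%classic.
Proof. exact: synthesis_cvgn (analysis_ell2 x). Qed.

Lemma frame_operatorP a x y :
  frame_operator ip f (a *: x + y) = a *: frame_operator ip f x + frame_operator ip f y.
Proof.
apply: cvg_lim; first exact: norm_hausdorff.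
have := cvgn_series_linear (a := a) (@frame_operator_cvgn x) (@frame_operator_cvgn y).
apply: cvg_trans; apply: near_eq_cvg; near=> n.
apply: eq_bigr => k _.
by rewrite linearDl /= ipZl scalerDl scalerA.
Unshelve. all: by end_near. Qed.

Lemma frame_operator_norm x : `|frame_operator ip f x| <= B%:C%C * `|x|.
Proof.
rewrite -ler_sqr ?nnegrE ?mulr_ge0 ?ler0c ?(ltW B0)//.
have [M cM _] := @ell2_series_cvgn _ _ (analysis_ell2 x).
apply: le_trans (synthesis_norm cM (@frame_operator_cvgn x)) _.
rewrite exprMn rnormE -!rmorphXn -rmorphM/= lecR expr2 -mulrA ler_pM2l//.
by rewrite -lee_fin -cM; exact: fB.
Qed.

(** Both sides equal the [ell2_dot] of the coefficient sequences of [x] and [y]. *)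
Lemma frame_operator_selfadjoint x y :
  ip (frame_operator ip f x) y = ip x (frame_operator ip f y).
Proof.
rewrite -(ell2_dot_analysisr ip_norm y (@frame_operator_cvgn x)).
exact (ell2_dot_analysisl ip_norm x (@frame_operator_cvgn y)).
Qed.

(** <S x, x> is the limit of the series of |<x, f_k>|^2, whose terms are nonnegative. The case n = 0
    serves later to get <S x, x> >= 0. *)
Lemma analysis_partial_le x n :
  \sum_(0 <= k < n) `|ip x (f k)| ^+ 2 <= ip (frame_operator ip f x) x.
Proof.
have h := cvgn_series_ipr ip_norm (y := x) (@frame_operator_cvgn x).
rewrite -subr_ge0; apply: (@cvgn_ge0 _ (fun m => _ - _)).
  by apply: cvgB h _; exact: cvg_cst.
near=> m; rewrite subr_ge0 /series/=.
have nm : (n <= m)%N by near: m; exact: nbhs_infty_ge.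
rewrite (big_cat_nat (leq0n n) nm)/=.
under eq_bigr do rewrite normCK.
by rewrite lerDl sumr_ge0// => k _; rewrite -normCK exprn_ge0.
Unshelve. all: by end_near. Qed.

End Bessel.

(** * Surjectivity of coercive bounded operators *)

Lemma normal_series_cvgn (R : realType) (V : completeNormedModType R[i])
    (u : nat -> V) (v : nat -> R) :
  (forall k, `|u k| <= (v k)%:C%C) -> cvgn (series v) -> cvgn (series u).
Proof.
move=> uv cv.
have v0 k : 0 <= v k by rewrite -ler0c (le_trans _ (uv k)).
have ndv : nondecreasing_seq (series v) by exact: nondecreasing_series.
(* The criterion bounds squared increments, so the dominating sequence is the square of the tail of
   [series v]. *)
apply: (@cvgn_of_dominated_increments _ _ _
  (fun m => (limn (series v) - series v m) * (limn (series v) - series v m))).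
  move=> m n mn; rewrite -expr2 rmorphXn/= ler_sqr ?nnegrE ?ler0c//; last first.
    by rewrite subr_ge0; exact: nondecreasing_cvgn_le.
  apply: (@le_trans _ _ (series v n - series v m)%:C%C); last first.
    by rewrite lecR lerD2r; exact: nondecreasing_cvgn_le.
  rewrite !sub_series_geq// rmorph_sum/=.
  by apply: le_trans (ler_norm_sum _ _ _) _; exact: ler_sum.
have h : ((fun m => limn (series v) - series v m) @ \oo --> (0 : R))%classic.
  by rewrite -(subrr (limn (series v))); apply: cvgB => //; exact: cvg_cst.
by rewrite -(mulr0 (0 : R)); apply: cvgM.
Qed.

(* Neumann series: the preimage of y is the sum of the residuals (I - T)^k y. *)
Lemma surjective_near_identity (R : realType) (V : completeNormedModType R[i])
    (T : V -> V) (q : R) :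
  {morph T : x y / x + y} -> 0 <= q < 1 ->
  (forall x, `|x - T x| <= q%:C%C * `|x|) -> forall y, exists x, T x = y.
Proof.
move=> TD /andP[q0 q1] Tq y.
have T0 : T 0 = 0 by apply: (addrI (T 0)); rewrite -TD !addr0.
have TB a b : T a - T b = T (a - b) by apply/eqP; rewrite subr_eq -TD subrK.
pose r n := iter n (fun x => x - T x) y.
have rq n : `|r n| <= (geometric (rnorm y) q n)%:C%C.
  elim: n => [|n IH]; first by rewrite /= mulr1 rnormE.
  apply: le_trans (Tq (r n)) _.
  rewrite /= exprS mulrCA rmorphM/= ler_wpM2l// ?ler0c//.
have cr : (cvgn (series r))%classic.
  apply: (normal_series_cvgn rq).
  by apply: is_cvg_geometric_series; rewrite ger0_norm.
(* The sum telescopes, since T r_k = r_k - r_(k+1). *)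
have Tr n : T (series r n) = y - r n.
  elim: n => [|n IH]; first by rewrite /series/= big_geq// T0 subrr.
  by rewrite seriesSr TD IH /= opprB addrA addrAC.
have r0 := cvg_series_cvg_0 cr.
exists (limn (series r)).
have Tcr : ((fun n => T (series r n)) @ \oo --> T (limn (series r)))%classic.
  (* [T] is Lipschitz with constant 1 + q, because T z = z - (z - T z). *)
  have K0 : 0 <= 1 + q%:C%C :> R[i] by rewrite addr_ge0// ler0c.
  apply: (cvgn_lipschitz K0 cr) => n; rewrite TB.
  set z := (_ - _).
  rewrite -{1}(subKr z (T z)) (le_trans (ler_normB _ _))//.
  by rewrite mulrDl mul1r lerD2l.
apply: (cvg_unique (@norm_hausdorff _ _) Tcr).
rewrite (_ : (fun n => _) = fun n => y - r n); last exact/funext.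
suff : ((fun n => y - r n) @ \oo --> y - 0)%classic by rewrite subr0.
by apply: cvgB => //; exact: cvg_cst.
Qed.

(* For t small, I - t S is a contraction. *)
Lemma coercive_surjective (R : realType) (H : completeNormedModType R[i])
    (ip : {dot H for Num.conj}) (S : H -> H) (A B : R) :
  induces_norm ip -> (forall a x y, S (a *: x + y) = a *: S x + S y) ->
  0 < A -> 0 < B -> (forall x, A%:C%C * `|x| ^+ 2 <= ip (S x) x) ->
  (forall x, `|S x| <= B%:C%C * `|x|) -> forall y, exists x, S x = y.
Proof.
move=> ip_norm SP A0 B0 SA SB y.
have S0 : S 0 = 0.
  apply: (addrI (S 0)); rewrite -[X in X + _]scale1r -SP scaler0 addr0.
  by rewrite addr0.
have AB0 : 0 < A + B by rewrite addr_gt0.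
(* |x - t S x|^2 is at most (1 - 2 t A + t^2 B^2) |x|^2. This choice gives t B^2 <= A, hence the
   bound 1 - t A = q^2; having A + B in the denominator also ensures t A < 1. *)
pose t := A / (A + B) ^+ 2.
have tE : t * (A + B) ^+ 2 = A by rewrite divfK// gt_eqF// exprn_gt0.
have t0 : 0 < t by rewrite divr_gt0// exprn_gt0.
have tA : t * A < 1 by nra.
move: (t) t0 tE tA => {}t {}t0 {}tE {}tA.
pose q := Num.sqrt (1 - t * A).
have qE : q ^+ 2 = 1 - t * A by rewrite sqr_sqrtr// subr_ge0 ltW.
have [|||x xy] := @surjective_near_identity _ H (fun x => t%:C%C *: S x) q _ _ _ (t%:C%C *: y).
- by move=> a b /=; rewrite -[a]scale1r SP scalerDr !scale1r.
- rewrite sqrtr_ge0 /= -(@ltr_sqr _ q 1) ?nnegrE ?sqrtr_ge0// qE expr1n.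
  by rewrite gtrBl mulr_gt0.
- move=> x; rewrite -ler_sqr ?nnegrE ?mulr_ge0 ?ler0c ?sqrtr_ge0//.
  have D0 : 0 <= ip (S x) x.
    by apply: le_trans (SA x); rewrite mulr_ge0 ?exprn_ge0// ler0c ltW.
  have DE := RRe_real (ger0_real D0).
  rewrite /= -(ip_norm (x - _)) dnormB dnormZ ipZr (ipC ip (S x) x) -DE !ip_norm.
  rewrite ger0_norm ?ler0c ?(ltW t0)// !rmorphM/= !conjC_real.
  move: (SA x) (SB x); rewrite -DE !rnormE.
  have : 0 <= rnorm (S x) by rewrite -ler0c -rnormE.
  have : 0 <= rnorm x by rewrite -ler0c -rnormE.
  move: (complex.Re _) (rnorm x) (rnorm (S x)) => d n m n0 m0.
  rewrite -!rmorphXn -!rmorphM -?rmorphD -!rmorphB /= !lecR => An mB.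
  rewrite -rmorphXn /= lecR exprMn qE.
  have tdn : t * (A * n ^+ 2) <= t * d by rewrite ler_pM2l.
  have mBn : m ^+ 2 <= (B * n) ^+ 2 by rewrite ler_sqr ?nnegrE ?mulr_ge0 ?(ltW B0).
  have tB : t * B ^+ 2 <= A.
    by rewrite -tE ler_pM2l// ler_sqr ?nnegrE ?(ltW B0) ?(ltW AB0)// lerDr ltW.
  have tmn : t ^+ 2 * m ^+ 2 <= t * A * n ^+ 2.
    apply: (@le_trans _ _ (t * (t * B ^+ 2) * n ^+ 2)); last first.
      by rewrite ler_wpM2r ?sqr_ge0// ler_pM2l.
    apply: (@le_trans _ _ (t ^+ 2 * (B * n) ^+ 2)).
      by rewrite ler_wpM2l ?sqr_ge0.
    by rewrite le_eqVlt; apply/orP; left; apply/eqP; ring.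
  lra.
exists x.
have t1 : t%:C%C != 0 :> R[i] by rewrite gt_eqF// ltcR.
exact: scalerI t1 _ _ xy.
Qed.

(** * The inverse frame operator and the cross-Gram operator *)

Section CrossGram.
Variables (R : realType) (H : completeNormedModType R[i]).
Variable ip : {dot H for Num.conj}.
Hypothesis ip_norm : induces_norm ip.
Variable f : nat -> H.
Hypothesis f_frame : is_frame ip f.

Lemma frame_operator_surjective y : exists x, frame_operator ip f x = y.
Proof.
have [A [B [A0 B0 fAB]]] := f_frame.
have fB x := (fAB x).2.
apply: (coercive_surjective ip_norm _ A0 B0).
- by move=> a u v; exact: (frame_operatorP ip_norm B0 fB).
- move=> x.
  (* Knowing that <S x, x> is real allows the comparison with the lower frame bound, which is stated
     in the extended reals. *)
  have /ger0_real/RRe_real Sx : 0 <= ip (frame_operator ip f x) x.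
    by have := analysis_partial_le ip_norm B0 fB x 0; rewrite big_geq.
  rewrite -Sx rnormE -rmorphXn -rmorphM/= lecR -lee_fin.
  apply: le_trans (fAB x).1 _; apply: sqsum_le => n.
  by rewrite -lecR -normr_sum_sqrE Sx; exact: (analysis_partial_le ip_norm B0 fB).
- by move=> x; exact: (frame_operator_norm ip_norm B0 fB).
Qed.

Let S := frame_operator ip f.
Let D := pinv setT S.

(** [pinv] selects a preimage, so surjectivity makes [D] a right inverse of [S]. Self-adjointness of
    [D] is then drawn from this identity and that of [S]. *)
Lemma pinv_frame_operatorK x : S (D x) = x.
Proof.
have [z <-] := frame_operator_surjective x.
by apply: pinvK; rewrite inE; exists z.
Qed.

(** <x, D f_j> = <S D x, D f_j> = <D x, S D f_j> = <D x, f_j>. *)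
Lemma cross_gram_canonicalE c x :
  (series (fun k => c k *: f k) @ \oo --> x)%classic ->
  cross_gram ip f (canonical_dual ip f) c = fun j => ip (D x) (f j).
Proof.
have [A [B [A0 B0 fAB]]] := f_frame.
have fB y := (fAB y).2.
move=> cx; apply/funext => j; rewrite /cross_gram /canonical_dual.
rewrite (cvg_lim (@norm_hausdorff _ _) cx) -/S -/D.
rewrite -[in LHS](pinv_frame_operatorK x) (frame_operator_selfadjoint ip_norm B0 fB).
by rewrite -/S pinv_frame_operatorK.
Qed.

End CrossGram.

Theorem theorem3p3 (R : realType) (H : completeNormedModType R[i])
    (ip : {dot H for Num.conj}) (ip_norm : induces_norm ip)
    (f : nat -> H) (f_frame : is_frame ip f) :
  let G := cross_gram ip f (canonical_dual ip f) in
  [/\ ell2_bounded_operator G, ell2_self_adjoint G & ell2_positive G].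
Proof.
move=> G.
have [A [B [A0 B0 fAB]]] := f_frame.
have fB x := (fAB x).2.
set S := frame_operator ip f; set D := pinv setT S.
have SD x : S (D x) = x by exact: pinv_frame_operatorK.
have SS x y : ip (S x) y = ip x (S y).
  exact: (frame_operator_selfadjoint ip_norm B0 fB).
(* <D x, y> = <D x, S D y> = <S D x, D y> = <x, D y>. *)
have DD x y : ip (D x) y = ip x (D y) by rewrite -{1}(SD y) -SS SD.
have Gcvg c : ell2 c -> exists2 x,
    (series (fun k => c k *: f k) @ \oo --> x)%classic &
    G c = fun j => ip (D x) (f j).
  move=> /(synthesis_cvgn ip_norm B0 fB) cx.
  by exists (limn (series (fun k => c k *: f k))) => //;
    exact: cross_gram_canonicalE.
have Spart x := analysis_partial_le ip_norm B0 fB x.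
split.
- split.
  + move=> c /Gcvg[x _ ->]; exact: (analysis_ell2 fB).
  + move=> a c d /Gcvg[x cx _] /Gcvg[y dy _].
    have cdxy := cvgn_series_linear (a := a) cx dy.
    apply/funext => j; rewrite /G /cross_gram.
    rewrite (cvg_lim (@norm_hausdorff _ _) cx) (cvg_lim (@norm_hausdorff _ _) dy).
    rewrite (_ : limn _ = a *: x + y); first by rewrite linearDl /= ipZl.
    apply: cvg_lim; first exact: norm_hausdorff.
    apply: cvg_trans cdxy; apply: near_eq_cvg; near=> n.
    by apply: eq_bigr => k _; rewrite scalerDl scalerA.
  (* Partial sums of |<D x, f_k>|^2 are at most <S D x, D x> = <x, D x>, which [ip_le_sqsum] with z
     = D x bounds by the square sum of [c]. *)
  + exists 1 => // c c2; rewrite expr1n mul1e.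
    have [x cx ->] := Gcvg c c2; have [M cM _] := ell2_series_cvgn c2.
    rewrite cM; apply: sqsum_le => n; rewrite -lecR -normr_sum_sqrE.
    apply: le_trans (Spart (D x) n) _; rewrite -/S SD.
    apply: (ip_le_sqsum ip_norm cx) => m; last first.
      by have := Spart (D x) m; rewrite -/S SD.
    by rewrite normr_sum_sqrE lecR -lee_fin -cM; exact: sqsum_ge_partial.
- move=> c d /Gcvg[x cx ->] /Gcvg[y dy ->].
  (* The two sides become <D x, y> and <x, D y>, equal by [DD]. *)
  rewrite (ell2_dot_analysisl ip_norm (D x) dy).
  by rewrite (ell2_dot_analysisr ip_norm (D y) cx).
- move=> c /Gcvg[x cx ->].
  rewrite (ell2_dot_analysisl ip_norm (D x) cx) DD -{1}(SD x).
  (* The goal is now 0 <= <S D x, D x>, the empty partial sum in [Spart]. *)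
  by have := Spart (D x) 0; rewrite big_geq.
Unshelve. all: by end_near. Qed.
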